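(* Let $n,k\ge 1$ be integers and let $A_1,\dots,A_k,B_1,\dots,B_k,C\in\mathcal{M}_n(\mathbb{C})$ be such that $\mathcal{N}=\{A_1,\dots,A_k,B_1,\dots,B_k,C\}$ is a commuting set of diagonalizable matrices. Let $S\in\mathfrak{S}(\mathcal{N})$, let $\Gamma^S$ be the relevant matrix with respect to $S$, let $(c_1,\dots,c_n)=\Delta_C(S)$, and let $\widehat{X}=\big(\sum_{j=1}^kA_jB_j\big)^{\mathbf{D}}C$. Then the following statements are equivalent. (i) The linear matrix equation $\sum_{j=1}^kA_jXB_j=C$ (with unknown $X\in\mathcal{M}_n(\mathbb{C})$) is consistent. (ii) For all $r\in\{1,\dots,n\}$ we have $\Gamma^S_{rr}\neq 0$ or $c_r=0$. (iii) $\widehat{X}$ is a solution of $\sum_{j=1}^kA_jXB_j=C$. (iv) The standard linear matrix equation $\big(\sum_{j=1}^kA_jB_j\big)X=C$ (with unknown $X\in\mathcal{M}_n(\mathbb{C})$) is consistent. (v) $\widehat{X}$ is a solution of $\big(\sum_{j=1}^kA_jB_j\big)X=C$.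
   Context: $\mathcal{M}_n(\mathbb{C})$ is the set of complex $n\times n$ matrices. A set of matrices is commuting if any two of its elements commute. An equation is consistent if it has at least one solution. For a diagonalizable $M\in\mathcal{M}_n(\mathbb{C})$, $\mathfrak{S}(M)$ is the set of invertible $S\in\mathcal{M}_n(\mathbb{C})$ such that $S^{-1}MS$ is diagonal, and for $S\in\mathfrak{S}(M)$, $\Delta_M(S)\in\mathbb{C}^n$ is the vector $\mathbf{m}$ with $\mathrm{diag}(\mathbf{m})=S^{-1}MS$. For a set $\mathcal{N}$ of diagonalizable matrices, $\mathfrak{S}(\mathcal{N})=\bigcap_{M\in\mathcal{N}}\mathfrak{S}(M)$ (nonempty when $\mathcal{N}$ is a commuting set). For $S\in\mathfrak{S}(\mathcal{N})$ put $\mathbf{a}^j=\Delta_{A_j}(S)=(a^j_1,\dots,a^j_n)$ and $\mathbf{b}^j=\Delta_{B_j}(S)=(b^j_1,\dots,b^j_n)$; the relevant matrix with respect to $S$ is $\Gamma^S\in\mathcal{M}_n(\mathbb{C})$ with entries $\Gamma^S_{rs}=\sum_{j=1}^ka^j_rb^j_s$. The Drazin inverse $A^{\mathbf{D}}$ of $A\in\mathcal{M}_n(\mathbb{C})$ is the unique matrix with $A^{p+1}A^{\mathbf{D}}=A^{p}$, $A^{\mathbf{D}}AA^{\mathbf{D}}=A^{\mathbf{D}}$, $A^{\mathbf{D}}A=AA^{\mathbf{D}}$, where $p=\mathrm{ind}(A)$ is the least nonnegative integer with $\mathrm{rank}(A^{p+1})=\mathrm{rank}(A^p)$. *)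

(* Defs.v *)
(* Mathematical Components; [R[i]] is the field of complex numbers over a
   [realType] R. *)
From mathcomp Require Export all_boot all_order all_algebra.
From mathcomp Require Export classical_sets reals.
From mathcomp Require Export complex.

Set Implicit Arguments.
Unset Strict Implicit.
Unset Printing Implicit Defensive.

Import GRing.Theory.

Local Open Scope ring_scope.
Local Open Scope classical_set_scope.

Section Diagonalizers.
Variables (F : fieldType) (n : nat).
Implicit Types (M S : 'M[F]_n) (N : set 'M[F]_n).

Definition commuting_set N : Prop :=
  forall M1 M2, N M1 -> N M2 -> comm_mx M1 M2.

Definition diagonalizers M : set 'M[F]_n :=
  [set S | S \in unitmx /\ is_diag_mx (invmx S *m M *m S)].

Definition codiagonalizers N : set 'M[F]_n :=
  \bigcap_(M in N) diagonalizers M.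

(* Meaningful only for [S] in [diagonalizers M], see [diag_mx_Delta]. *)
Definition Delta M S : 'rV[F]_n := \row_i (invmx S *m M *m S) i i.

Lemma diag_mx_Delta M S :
  diagonalizers M S -> diag_mx (Delta M S) = invmx S *m M *m S.
Proof.
move=> [_ /is_diag_mxP dS]; apply/matrixP => i j; rewrite mxE mxE.
by have [<-|nij] := eqVneq i j; rewrite ?mulr1n // mulr0n dS.
Qed.

Definition relevant_mx (k : nat) (A B : 'I_k -> 'M[F]_n) S : 'M[F]_n :=
  \matrix_(r, s) \sum_(j < k) Delta (A j) S 0 r * Delta (B j) S 0 s.

End Diagonalizers.

Section Drazin.
Variables (F : fieldType) (n : nat).
Implicit Types A D : 'M[F]_n.

Lemma mx_index_exists A : exists p, \rank (A ^+ p.+1) == \rank (A ^+ p).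
Proof.
suff H p : (exists q, \rank (A ^+ q.+1) == \rank (A ^+ q)) \/
           (\rank (A ^+ p) + p <= n)%N.
  by case: (H n.+1) => // /(leq_trans (leq_addl _ _)); rewrite ltnn.
elim: p => [|p [IH|IH]]; [|by left|].
  by right; rewrite addn0 rank_leq_row.
have [e|ne] := eqVneq (\rank (A ^+ p.+1)) (\rank (A ^+ p)).
  by left; exists p; rewrite e.
right; rewrite addnS -addSn; apply: leq_trans IH; rewrite leq_add2r.
by rewrite ltn_neqAle ne /= exprS mxrankM_maxr.
Qed.

Definition mx_index A : nat := ex_minn (mx_index_exists A).

Definition is_drazin A D : bool :=
  let p := mx_index A in
  [&& A ^+ p.+1 *m D == A ^+ p, D *m A *m D == D & D *m A == A *m D].

Lemma drazin_exists A : exists D, is_drazin A D.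
Proof.
rewrite /is_drazin /mx_index; case: ex_minnP => p /eqP rk _.
have [Y eY] : exists Y, A ^+ p = Y * A ^+ p.+1.
  have s : (A ^+ p.+1 <= A ^+ p)%MS by rewrite exprS; apply: submxMl.
  by apply/submxP; rewrite -(geq_leqif (mxrank_leqif_sup s)) rk.
have [Z eZ] : exists Z, A ^+ p = A ^+ p.+1 * Z.
  have s : ((A ^+ p.+1)^T <= (A ^+ p)^T)%MS.
    by rewrite exprSr trmx_mul; apply: submxMl.
  have /submxP[W eW] : ((A ^+ p)^T <= (A ^+ p.+1)^T)%MS.
    by rewrite -(geq_leqif (mxrank_leqif_sup s)) !mxrank_tr rk.
  by exists W^T; apply: trmx_inj; rewrite eW trmx_mul trmxK.
have Zq q : A ^+ (p + q) * Z ^+ q = A ^+ p.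
  elim: q => [|q IH]; first by rewrite addn0 mulr1.
  rewrite addnS -addSn addnC exprD [Z ^+ _]exprS mulrA.
  by rewrite -(mulrA (A ^+ q)) -eZ -exprD addnC.
have Yq q : Y ^+ q * A ^+ (p + q) = A ^+ p.
  elim: q => [|q IH]; first by rewrite addn0 mul1r.
  by rewrite addnS -addSn exprD [Y ^+ _]exprSr mulrA -(mulrA (Y ^+ q)) -eY -mulrA -exprD.
have YZ q : Y ^+ q * A ^+ p = A ^+ p * Z ^+ q.
  by rewrite -{1}(Zq q) mulrA Yq.
have AD : A * (A ^+ p * Z ^+ p.+1) = A ^+ p * Z ^+ p.
  by rewrite mulrA -exprS [Z ^+ _]exprS mulrA -eZ.
have DA : A ^+ p * Z ^+ p.+1 * A = A ^+ p * Z ^+ p.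
  by rewrite -YZ -mulrA -exprSr [Y ^+ _]exprSr -mulrA -eY YZ.
exists (A ^+ p * Z ^+ p.+1); apply/and3P; split; apply/eqP.
- rewrite -/(A ^+ p.+1 * (A ^+ p * Z ^+ p.+1)) mulrA -exprD addnC; exact: Zq.
- rewrite -/(A ^+ p * Z ^+ p.+1 * A * (A ^+ p * Z ^+ p.+1)) DA -YZ.
  by rewrite -mulrA (mulrA (A ^+ p)) -exprD mulrA Yq.
- exact: etrans DA (esym AD).
Qed.

Definition drazin A : 'M[F]_n := xchoose (drazin_exists A).

Lemma drazinP A : is_drazin A (drazin A).
Proof. exact: xchooseP. Qed.

Lemma drazin_unique A D : is_drazin A D -> D = drazin A.
Proof.
move: (drazinP A); rewrite /is_drazin; set p := mx_index A; move: (drazin A) => E.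
pose cond X := [/\ A ^+ p.+1 * X = A ^+ p, X * A * X = X & X * A = A * X].
move=> /and3P[/eqP a1 /eqP b1 /eqP c1] /and3P[/eqP a2 /eqP b2 /eqP c2].
have {a1 b1 c1} cE : cond E by [].
have {a2 b2 c2} cD : cond D by [].
have pwl q X : cond X -> X = A ^+ q * X ^+ q.+1.
  move=> [_ b c]; elim: q => [|q IH]; first by rewrite expr1 mul1r.
  by rewrite exprSr -mulrA [X ^+ q.+2]exprS [X ^+ q.+1]exprS !mulrA
    -[_ * A * X]mulrA -[_ * (A * X) * X]mulrA -c b -mulrA -exprS.
have absr X : cond X -> X * A * A ^+ p = A ^+ p.
  move=> [a _ c]; rewrite -mulrA -exprS -[RHS]a.
  by apply: commrX; exact: c.
have pwr X : cond X -> X = X ^+ p.+1 * A ^+ p.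
  move=> cX; rewrite {1}(pwl p X cX); apply: commr_sym; apply: commrX.
  by apply: commr_sym; apply: commrX; case: cX.
have -> : D = E * A * D by rewrite {2}(pwl p D cD) mulrA (absr E cE) -(pwl p D cD).
rewrite {1}(pwr E cE) -!mulrA (mulrA _ A) -exprSr.
by case: cD => -> _ _; rewrite -(pwr E cE).
Qed.

End Drazin.

(* Main.v *)
(* Conjugation by S turns both equations into entrywise ones: with
   Y = S^-1 X S they read Gamma_rs Y_rs = c_r [r = s] and
   Gamma_rr Y_rs = c_r [r = s].  Off the diagonal both are solved by 0 and on
   the diagonal they coincide, so solvability of either one amounts to
   Gamma_rr <> 0 or c_r = 0; in that case Y = diag (c_r / Gamma_rr), with
   x / 0 = 0, solves both, and this Y comes from Xhat. *)
Require Import Defs.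

Set Implicit Arguments.
Unset Strict Implicit.
Unset Printing Implicit Defensive.

Import GRing.Theory.

Local Open Scope ring_scope.
Local Open Scope classical_set_scope.

(* A matrix with a group inverse has index at most 1. *)
Lemma drazin_group_inverse (F : fieldType) (n : nat) (A D : 'M[F]_n) :
  A *m A *m D = A -> D *m A *m D = D -> D *m A = A *m D -> drazin A = D.
Proof.
move=> AAD DAD comDA; apply/esym/drazin_unique; apply/and3P; split; last 2 first.
- exact/eqP.
- exact/eqP.
(* For a positive index, [A *m A *m D = A] multiplied on the left by a power of [A] suffices. For
   index 0, [A] has the rank of the identity, so it is invertible and can be cancelled to give
   [A *m D = 1]. *)
rewrite /mx_index; case: ex_minnP => -[|p] /eqP rk _; apply/eqP; last first.
  have -> : A ^+ p.+2 = A ^+ p *m (A *m A) by rewrite !exprSr -mulrA.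
  by rewrite -mulmxA AAD exprSr.
have uA : A \in unitmx.
  by rewrite -row_full_unit /row_full -[A in \rank A]expr1 rk mxrank1.
by rewrite expr1 expr0 -(mulKmx uA (A *m D)) (mulmxA A) AAD mulVmx.
Qed.

Section SimultaneousDiagonalization.
Variables (F : fieldType) (n : nat) (S : 'M[F]_n).
Hypothesis uS : S \in unitmx.

Definition similar_by (M : 'M[F]_n) : 'M[F]_n := invmx S *m M *m S.

Lemma similar_byM M1 M2 :
  similar_by (M1 *m M2) = similar_by M1 *m similar_by M2.
Proof. by rewrite /similar_by !mulmxA mulmxK. Qed.

Lemma similar_by_sum (I : finType) (M : I -> 'M[F]_n) :
  similar_by (\sum_i M i) = \sum_i similar_by (M i).
Proof. by rewrite /similar_by mulmx_sumr mulmx_suml. Qed.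

Lemma similar_by_inj : injective similar_by.
Proof.
move=> M1 M2; rewrite /similar_by => e.
by rewrite -[M1](mulKVmx uS) -[M2](mulKVmx uS) -[invmx S *m M1](mulmxK uS) e mulmxK.
Qed.

Lemma similar_by_surj M : exists X, similar_by X = M.
Proof. by exists (S *m M *m invmx S); rewrite /similar_by mulmxA mulmxKV // mulKmx. Qed.

(** Conjugation is injective and multiplicative, so the group inverse identities can be checked on
    diagonal entries. The convention [0^-1 = 0] makes them hold at zero entries too. *)
Lemma similar_by_drazin_diag M (d : 'rV[F]_n) :
  similar_by M = diag_mx d ->
  similar_by (drazin M) = diag_mx (\row_i (d 0 i)^-1).
Proof.
move=> Md; have [D De] := similar_by_surj (diag_mx (\row_i (d 0 i)^-1)).
suff -> : drazin M = D by [].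
apply: drazin_group_inverse; apply: similar_by_inj;
  rewrite !similar_byM Md De !mulmx_diag; congr diag_mx; apply/rowP=> i; rewrite !mxE.
- by have [->|nz] := eqVneq (d 0 i) 0; rewrite ?mul0r // mulfK.
- by have [->|nz] := eqVneq (d 0 i) 0; rewrite ?invr0 ?mul0r // mulVf // mul1r.
- by rewrite mulrC.
Qed.

Variables (k : nat) (A B : 'I_k -> 'M[F]_n) (C : 'M[F]_n).
Hypotheses (dA : forall j, diagonalizers (A j) S)
           (dB : forall j, diagonalizers (B j) S) (dC : diagonalizers C S).

Local Notation Gamma := (relevant_mx A B S).
Local Notation AB := (\sum_(j < k) A j *m B j).
Local Notation Xhat := (drazin AB *m C).

(** After conjugation each [A j] scales row [r] and each [B j] scales column [s]; summing the
    products of these factors over [j] gives [Gamma r s]. *)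
Lemma similar_by_sandwich X r s :
  similar_by (\sum_(j < k) A j *m X *m B j) r s = Gamma r s * similar_by X r s.
Proof.
rewrite similar_by_sum summxE mxE mulr_suml; apply: eq_bigr => j _.
rewrite !similar_byM -[similar_by (A j)]diag_mx_Delta // -[similar_by (B j)]diag_mx_Delta //.
by rewrite mul_mx_diag mxE mul_diag_mx mxE mulrAC.
Qed.

Lemma similar_by_sum_mul :
  similar_by AB = diag_mx (\row_r Gamma r r).
Proof.
rewrite similar_by_sum.
under eq_bigr do rewrite similar_byM
  -[similar_by (A _)]diag_mx_Delta // -[similar_by (B _)]diag_mx_Delta // mulmx_diag.
rewrite -raddf_sum; congr diag_mx; apply/rowP=> i; rewrite summxE !mxE.
by apply: eq_bigr => j _; rewrite mxE.
Qed.

Lemma similar_by_Xhat :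
  similar_by Xhat = diag_mx (\row_r (Delta C S 0 r / Gamma r r)).
Proof.
rewrite similar_byM (similar_by_drazin_diag similar_by_sum_mul).
rewrite -[similar_by C]diag_mx_Delta // mulmx_diag.
by congr diag_mx; apply/rowP=> r; rewrite 3!mxE [RHS]mxE mulrC.
Qed.

(** The conjugate of [Xhat] is diagonal, and the factors [Gamma r s] and [Gamma r r] differ only off
    the diagonal. Hence (iii) and (v) are the same equation. *)
Lemma sandwich_Xhat : \sum_(j < k) A j *m Xhat *m B j = AB *m Xhat.
Proof.
apply: similar_by_inj; apply/matrixP=> r s.
rewrite similar_by_sandwich [in RHS]similar_byM similar_by_sum_mul mul_diag_mx.
rewrite similar_by_Xhat [RHS]mxE [X in X * _ = _]lock !mxE -lock.
have [->|_] := eqVneq r s; first by rewrite ?mxE.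
by rewrite !mulr0n !mulr0.
Qed.

Lemma mul_Xhat_eq :
  (forall r, Gamma r r <> 0 \/ Delta C S 0 r = 0) -> AB *m Xhat = C.
Proof.
move=> G; apply: similar_by_inj; rewrite similar_byM similar_by_sum_mul.
rewrite similar_by_Xhat mulmx_diag -[similar_by C]diag_mx_Delta //.
congr diag_mx; apply/rowP=> r.
rewrite mxE [X in X * _]mxE [X in _ * X]mxE mulrC.
(* Where [Gamma r r] may vanish, [c_r = 0] makes both sides zero. *)
by case: (G r) => [/eqP nz|->]; [rewrite mulfVK | rewrite !mul0r].
Qed.

(** Both equations impose this same condition on the diagonal of a conjugated solution, so it serves
    (i) and (iv) alike. *)
Lemma diag_entries_neq0 (Y : 'M[F]_n) :
  (forall r, Gamma r r * Y r r = similar_by C r r) ->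
  forall r, Gamma r r <> 0 \/ Delta C S 0 r = 0.
Proof.
move=> e r; have [G0|/eqP] := eqVneq (Gamma r r) 0; last by left.
by right; rewrite mxE -/(similar_by C) -e G0 mul0r.
Qed.

End SimultaneousDiagonalization.

Theorem theorem2p5 (R : realType) (n k : nat) (hn : (0 < n)%N) (hk : (0 < k)%N)
    (A B : 'I_k -> 'M[R[i]]_n) (C : 'M[R[i]]_n)
    (N := range A `|` range B `|` [set C])
    (hcomm : commuting_set N)
    (hdiag : forall M, N M -> diagonalizable M)
    (S : 'M[R[i]]_n) (hS : codiagonalizers N S)
    (Xhat := drazin (\sum_(j < k) A j *m B j) *m C) :
  [<-> (* (i) *)
       exists X : 'M[R[i]]_n, \sum_(j < k) A j *m X *m B j = C;
       (* (ii) *)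
       forall r : 'I_n, relevant_mx A B S r r <> 0 \/ Delta C S 0 r = 0;
       (* (iii) *)
       \sum_(j < k) A j *m Xhat *m B j = C;
       (* (iv) *)
       exists X : 'M[R[i]]_n, (\sum_(j < k) A j *m B j) *m X = C;
       (* (v) *)
       (\sum_(j < k) A j *m B j) *m Xhat = C].
Proof.
have dA j : diagonalizers (A j) S by apply: hS; left; left; exists j.
have dB j : diagonalizers (B j) S by apply: hS; left; right; exists j.
have dC : diagonalizers C S by apply: hS; right.
have uS : S \in unitmx by case: dC.
have XhatE := sandwich_Xhat uS dA dB dC.
tfae.
- move=> [X e]; apply: (diag_entries_neq0 (Y := similar_by S X)) => r.
  by rewrite -e similar_by_sandwich.
- by move=> G; rewrite XhatE; exact: (mul_Xhat_eq uS dA dB dC).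
- by move=> e; exists Xhat; rewrite -XhatE.
(* From (iv) to (v) by way of (ii), read off the diagonal of the conjugated equation. *)
- move=> [X e]; apply: (mul_Xhat_eq uS dA dB dC).
  apply: (diag_entries_neq0 (Y := similar_by S X)) => r.
  rewrite -e similar_byM // (similar_by_sum_mul uS dA dB) mul_diag_mx.
  by rewrite [RHS]mxE [X in _ = X * _]mxE.
- by move=> e; exists Xhat; rewrite XhatE.
Qed.
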